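(* Let $k\ge1$, $c\ge0$ be integers, $s>0$, $\mu>0$, $\Delta\ge0$, and let $q=\mathbf 1(\Delta>s)\bigl(1-e^{-\mu(\Delta-s)}\bigr)$. Consider executing a job of $k$ tasks by adding $c$ replicas for each task remaining at time $\Delta$ (model in the context), where task-copy execution times are i.i.d. $\mathrm{SExp}(s,\mu)$. Let $T$ be the job execution time, and let $T_e$ be the job execution time in the same model (same $k,c,\Delta$) when task-copy execution times are i.i.d. $\mathrm{Exp}(\mu)$. Then for all $t$ $$\Pr\{T>t\}=\Pr\{T_e>t-s\},\qquad \mathbb E[T]=s+\mathbb E[T_e].$$ The expected cost with task cancellation is $$\mathbb E[C^c]=\begin{cases}k(c+1)\Bigl(s+\dfrac1\mu\Bigl(1-\dfrac{c}{c+1}\bigl(e^{-\mu\Delta}+\mu\Delta\bigr)\Bigr)\Bigr) & \Delta\le s,\\[2mm] k\Bigl(s+\dfrac1\mu\bigl(1+c(1-q-e^{-\mu\Delta})\bigr)\Bigr) & \Delta>s,\end{cases}$$ and the expected cost without task cancellation is $$\mathbb E[C]=k\bigl(c(1-q)+1\bigr)\Bigl(s+\frac1\mu\Bigr).$$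
   Context: $\mathrm{SExp}(s,\mu)$ is the shifted exponential distribution: $\Pr\{X>x\}=e^{-\mu(x-s)}$ for $x\ge s$ and $1$ for $x<s$. Delayed replication model. Let $X_{i,l}$, $1\le i\le k$, $0\le l\le c$, be i.i.d. task-copy execution times. At time $0$ the original copies $(i,0)$ of all $k$ tasks are launched. For every task $i$ whose original has not completed by time $\Delta$ (i.e. $X_{i,0}>\Delta$), $c$ replicas $(i,1),\dots,(i,c)$ are launched at time $\Delta$; the original keeps running. The completion time of task $i$ is $Y_i=X_{i,0}$ if $X_{i,0}\le\Delta$, and $Y_i=\min\{X_{i,0},\Delta+\min_{1\le l\le c}X_{i,l}\}$ otherwise. The job completes when all tasks do: $T=\max_i Y_i$. Cost is the sum of the lifetimes of all launched copies (from launch to completion or cancellation). With task cancellation, all outstanding copies of a task are cancelled instantly when the task completes, so task $i$ contributes $X_{i,0}$ to $C^c$ if $X_{i,0}\le\Delta$ and $\Delta+(c+1)(Y_i-\Delta)$ otherwise. Without cancellation every launched copy runs to completion, so task $i$ contributes $X_{i,0}+\mathbf 1(X_{i,0}>\Delta)\sum_{l=1}^c X_{i,l}$ to $C$. $\mathbf 1(\cdot)$ is the indicator. *)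

(* Defs.v *)
From HB Require Import structures.
From mathcomp Require Export all_boot all_order all_algebra.
From mathcomp Require Export all_classical all_reals all_analysis.

Set Implicit Arguments.
Unset Strict Implicit.
Unset Printing Implicit Defensive.

Import Order.TTheory GRing.Theory Num.Theory.

Local Open Scope classical_set_scope.
Local Open Scope ring_scope.

Definition mutually_independent (d : measure_display) (Om : measurableType d)
    (R : realType) (P : probability Om R) (I : finType)
    (X : I -> {RV P >-> R}) : Prop :=
  forall (J : {set I}) (A : I -> set R), (forall i, measurable (A i)) ->
    P [set w | forall i, i \in J -> A i (X i w)] =
    (\prod_(i in J) P (X i @^-1` A i))%E.

Definition has_sexp_law (d : measure_display) (Om : measurableType d)
    (R : realType) (P : probability Om R) (s mu : R) (X : {RV P >-> R}) : Prop :=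
  forall x : R,
    ccdf X x = (if s <= x then expR (- mu * (x - s)) else 1)%:E.

(* The two laws are compared on measurable sets only: elsewhere the values of
   [distribution] and [exponential_prob] carry no meaning. *)
Definition has_exp_law (d : measure_display) (Om : measurableType d)
    (R : realType) (P : probability Om R) (mu : R) (X : {RV P >-> R}) : Prop :=
  forall A : set R, measurable A ->
    distribution P X A = exponential_prob mu A.

(* In what follows [x i l] is a realization of the execution time of copy [l]
   of task [i]: [ord0] indexes the original copy and [lift ord0 l], for
   [l : 'I_c], the replicas launched at time [D]. *)

(* Seeding the minimum with [x i ord0] yields
   min {x_{i,0}, D + x_{i,1}, ..., D + x_{i,c}}, which is x_{i,0} if c = 0. *)
Definition task_time (R : realType) (k c : nat) (D : R)
    (x : 'I_k -> 'I_c.+1 -> R) (i : 'I_k) : R :=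
  if x i ord0 <= D then x i ord0
  else \big[Num.min/x i ord0]_(l < c) (D + x i (lift ord0 l)).

(* The seed is the completion time of the first task, so that this is the
   maximum over all tasks, without any sign assumption. *)
Definition job_time (R : realType) (k c : nat) (k_gt0 : (0 < k)%N) (D : R)
    (x : 'I_k -> 'I_c.+1 -> R) : R :=
  \big[Num.max/task_time D x (Ordinal k_gt0)]_(i < k) task_time D x i.

Definition cost_cancel (R : realType) (k c : nat) (D : R)
    (x : 'I_k -> 'I_c.+1 -> R) : R :=
  \sum_(i < k)
    (if x i ord0 <= D then x i ord0
     else D + c.+1%:R * (task_time D x i - D)).

Definition cost_no_cancel (R : realType) (k c : nat) (D : R)
    (x : 'I_k -> 'I_c.+1 -> R) : R :=
  \sum_(i < k)
    (x i ord0 + (D < x i ord0)%R%:R * \sum_(l < c) x i (lift ord0 l)).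

(* Main.v *)
(* Almost surely every copy takes longer than s >= 0, and then the completion
   time of a task is min_l (X_l + D 1(l > 0)), whether or not the original
   finishes before D.  So {T > t} is a function of the finitely many bits
   1(X_{i,l} > t - D 1(l > 0)); these are independent and have the same law as
   the bits 1(E_{i,l} > t - s - D 1(l > 0)), which gives the first identity, and
   the second by integrating tails.  For the costs, a task contributes
   Y + c (Y - D)^+ and, with X the time of its original copy,
     Y = s + (X - s)^+ - (X - (D + s))^+ + (Y - (D + s))^+,
     (Y - D)^+ = (X - D)^+ - (X - (D + s))^+ + (Y - (D + s))^+,
   where the excess of X over any level >= s, and that of Y over D + s, have
   purely exponential tails p e^{-bt} on t >= 0, hence mean p / b.  The second
   identity is used for D > s; when D <= s, (Y - D)^+ = Y - D.  Without
   cancellation, 1(X > D) (X_l - s)^+ has such a tail by independence. *)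
Require Import Defs.
From mathcomp Require Import all_boot all_order all_algebra.
From mathcomp Require Import all_classical all_reals all_analysis.
From mathcomp Require Import measurable_realfun ring lra.

Set Implicit Arguments.
Unset Strict Implicit.
Unset Printing Implicit Defensive.

Import Order.TTheory GRing.Theory Num.Theory.
Import numFieldNormedType.Exports.

Local Open Scope classical_set_scope.
Local Open Scope ring_scope.

(** * Integrals of exponential tails *)

Lemma measurable_expRM {R : realType} (b : R) (A : set R) :
  measurable_fun A (fun x => expR (b * x)).
Proof.
by apply/measurable_funTS; apply: measurableT_comp.
Qed.

Lemma integral_expR {R : realType} (a b : R) : 0 < b ->
  (\int[lebesgue_measure]_(x in `[a, +oo[) (expR (- b * x))%:E)%E =
  (expR (- b * a) / b)%:E.
Proof.
move=> b0; pose F (x : R) := - (expR (- b * x) / b).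
have dF (x : R) : is_derive x 1 F (expR (- b * x)).
  rewrite /F; apply: is_derive_eq.
  by rewrite /GRing.scale/=; field; rewrite gt_eqF.
rewrite (@ge0_continuous_FTC2y _ (fun x => expR (- b * x)) F a 0).
- by rewrite /F -EFinB sub0r opprK.
- by move=> x _; exact: expR_ge0.
- apply: continuous_subspaceT; move=> x.
  apply/differentiable_continuous/derivable1_diffP.
  exact: ex_derive.
(* The limit [0] is rewritten as [- (0 * b^-1)] to match the shape of [F]. *)
- rewrite -oppr0 -(mul0r b^-1); apply: cvgN; apply: cvgM; last exact: cvg_cst.
  rewrite (_ : (fun x => expR (- b * x)) =
               (fun z => expR (- z)) \o (fun z => b * z)); last first.
    by apply: eq_fun => x; rewrite mulNr.
  apply: (@cvg_comp _ _ _ _ _ _ (pinfty_nbhs R)); last exact: cvgr_expR.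
  exact: gt0_cvgMry.
- by move=> x _; have [] := dF x.
- apply: cvg_at_right_filter.
  apply/differentiable_continuous/derivable1_diffP.
  by have [] := dF a.
- by move=> x _; rewrite derive1E; apply: derive_val.
Qed.

(** * Pathwise identities for completion times and costs *)

Section min_time.
Context {R : realType} {k c : nat} (D : R).
Implicit Types (x : 'I_k -> 'I_c.+1 -> R) (i : 'I_k) (l : 'I_c.+1) (t : R).

Definition launch l : R := if l == ord0 then 0 else D.

(** The completion time in a variant where replicas start at [D] in every case, even if the original
    is already done. It has no case distinction, so its tail events factor over the copies. *)
Definition min_time x i : R :=
  \big[Num.min/x i ord0]_(l < c) (D + x i (lift ord0 l)).

Lemma min_time_gtP x i t :
  t < min_time x i <-> forall l, t - launch l < x i l.
Proof.
rewrite /min_time /launch; split=> [/bigmin_gtP[t0 tl] l|tl].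
  by case: (unliftP ord0 l) => [j|] ->; rewrite ?eqxx/= ?subr0// ltrBlDl tl.
apply/bigmin_gtP; split=> [|j _]; first by have := tl ord0; rewrite eqxx subr0.
by have := tl (lift ord0 j); rewrite /= ltrBlDl.
Qed.

(** A replica started at [D] ends no earlier than [D], so it cannot beat an original that is done by
    then. *)
Lemma task_timeE x i : (forall l, 0 <= x i l) -> task_time D x i = min_time x i.
Proof.
move=> x0; rewrite /task_time /min_time; case: ifPn => // xD.
apply/le_anti; rewrite bigmin_le_id andbT.
by apply/bigmin_geP; split=> // j _; rewrite (le_trans xD)// lerDl.
Qed.

Lemma min_time_le x i : min_time x i <= x i ord0.
Proof. exact: bigmin_le_id. Qed.

Lemma min_time_ge x i t : t <= x i ord0 ->
  (forall l, t - D <= x i l) -> t <= min_time x i.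
Proof. by move=> t0 tl; apply/bigmin_geP; split=> // j _; rewrite -lerBlDl. Qed.

(** No replica ends before [D + s]; up to that level only the original matters. *)
Lemma min_time_cases x i s : (forall l, s <= x i l) -> 0 <= D ->
  min_time x i = x i ord0 /\ x i ord0 <= D + s \/ D + s <= min_time x i.
Proof.
move=> sx D0; have [xDs|/ltW Dsx] := leP (x i ord0) (D + s).
  left; split=> //; apply/le_anti; rewrite min_time_le/=.
  by apply: min_time_ge => // l; rewrite (le_trans _ (sx l))// lerBlDl.
by right; apply: min_time_ge => // l; rewrite addrC addKr.
Qed.

(** The first three terms amount to [x i ord0] truncated at [D + s], which is also [min_time x i]
    truncated there; the last term restores what exceeds [D + s]. *)
Lemma min_time_split x i s : (forall l, s <= x i l) -> 0 <= D ->
  min_time x i = s + Num.max (x i ord0 - s) 0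
    - Num.max (x i ord0 - (D + s)) 0 + Num.max (min_time x i - (D + s)) 0.
Proof.
move=> sx D0; have := sx ord0; have := min_time_le x i.
by case: (min_time_cases sx D0); rewrite /Num.max; do 3 case: ifPn; lra.
Qed.

(** The difference of the first two terms is the length of the part of [[D, D + s]] that lies below
    [x i ord0], and [min_time x i] gives the same length. *)
Lemma min_time_excess x i s : (forall l, s <= x i l) -> 0 <= D -> 0 <= s ->
  Num.max (min_time x i - D) 0 = Num.max (x i ord0 - D) 0
    - Num.max (x i ord0 - (D + s)) 0 + Num.max (min_time x i - (D + s)) 0.
Proof.
move=> sx D0 s0; have := min_time_le x i.
by case: (min_time_cases sx D0); rewrite /Num.max; do 4 case: ifPn; lra.
Qed.

(** If the original outlasts [D], the completion time is at least [D] and the two forms agree by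
    algebra; otherwise the positive part vanishes. *)
Lemma cost_cancelE x : (forall i l, 0 <= x i l) ->
  cost_cancel D x =
  \sum_(i < k) (min_time x i + c%:R * Num.max (min_time x i - D) 0).
Proof.
move=> x0; apply: eq_bigr => i _; rewrite task_timeE//.
have xm := min_time_le x i.
case: ifPn => [xD|]; last first.
  rewrite -ltNge => Dx.
  have Dm : D <= min_time x i.
    by apply: min_time_ge => [|l]; [exact: ltW | rewrite subrr].
  by rewrite max_l ?subr_ge0// -natr1; ring.
rewrite max_r ?subr_le0 ?(le_trans xm)// mulr0 addr0 -task_timeE//.
by rewrite /task_time xD.
Qed.

End min_time.

(** * Measurability, and events equal almost surely *)

Section measurability.
Context {R : realType} {d : measure_display} {Om : measurableType d}.

Lemma measurable_bigr (op : R -> R -> R) n (f : 'I_n -> Om -> R) (g : Om -> R) :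
  (forall f1 f2 : Om -> R, measurable_fun setT f1 -> measurable_fun setT f2 ->
    measurable_fun setT (fun w => op (f1 w) (f2 w))) ->
  measurable_fun setT g -> (forall i, measurable_fun setT (f i)) ->
  measurable_fun setT (fun w => \big[op/g w]_(i < n) f i w).
Proof.
move=> mop mg; elim: n f => [|n IHn] f mf.
  by under eq_fun do rewrite big_ord0.
by under eq_fun do rewrite big_ord_recl; apply: mop => //; exact: IHn.
Qed.

Lemma measurable_gtr (f : Om -> R) t :
  measurable_fun setT f -> measurable [set w | t < f w].
Proof.
move=> mf; have := mf measurableT `]t, +oo[%classic (measurable_itv _).
rewrite setTI (_ : _ @^-1` _ = [set w | t < f w])//.
by apply/seteqP; split=> w /=; rewrite in_itv/= andbT.
Qed.

(** Each event is contained in the union of the other with a measurable null set. *)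
Lemma ae_eq_prob (P : probability Om R) (A B : set Om) :
  measurable A -> measurable B -> {ae P, forall w, A w <-> B w} -> P A = P B.
Proof.
move=> mA mB [N [mN N0 ABN]].
have aeP (U V : set Om) : measurable U -> measurable V ->
    ~` (fun w => U w -> V w) `<=` N -> (P U <= P V)%E.
  move=> mU mV UVN; rewrite -[leRHS]adde0 -N0.
  apply: le_trans (measureU2 _ _ _) => //.
  rewrite le_measure ?inE//; first exact: measurableU.
  move=> w Uw; have [Vw|nVw] := pselect (V w); first by left.
  by right; apply: UVN => /= /(_ Uw).
by apply/le_anti/andP; split; apply: aeP => // w /= nUV; apply: ABN => /= -[].
Qed.

End measurability.

(** * Finite means and the tail formula *)

Section expectation.
Context {R : realType} {d : measure_display} {Om : measurableType d}.
Context (P : probability Om R).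
Implicit Types (f g : Om -> R) (m p b : R).

(** Integrability is bundled with the value, so that means can be added, subtracted and scaled
    without further side conditions. *)
Definition has_mean f m :=
  P.-integrable setT (EFin \o f) /\ (\int[P]_w (f w)%:E)%E = m%:E.

Lemma has_meanE f m : has_mean f m -> ('E_P[f])%E = m%:E.
Proof. by rewrite unlock => -[]. Qed.

Lemma ge0_has_mean f m : measurable_fun setT f -> (forall w, 0 <= f w) ->
  (\int[P]_w (f w)%:E)%E = m%:E -> has_mean f m.
Proof.
move=> mf f0 fm; split=> //; apply/integrableP; split.
  exact/measurable_EFinP.
under eq_integral do rewrite /= ger0_norm//.
by rewrite fm ltry.
Qed.

Lemma has_meanD f g m p :
  has_mean f m -> has_mean g p -> has_mean (fun w => f w + g w) (m + p).
Proof.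
move=> [If mf] [Ig mg]; split.
  exact: (@integrableD _ _ _ P setT measurableT (EFin \o f) (EFin \o g)).
by under eq_integral do rewrite EFinD; rewrite integralD// mf mg.
Qed.

Lemma has_meanZ b f m : has_mean f m -> has_mean (fun w => b * f w) (b * m).
Proof.
move=> [If mf]; split.
  exact: (@integrableZl _ _ _ P setT measurableT b (EFin \o f)).
by under eq_integral do rewrite EFinM; rewrite integralZl// mf.
Qed.

Lemma has_meanB f g m p :
  has_mean f m -> has_mean g p -> has_mean (fun w => f w - g w) (m - p).
Proof.
move=> mf /(has_meanZ (-1)) mg; have := has_meanD mf mg.
by under eq_fun do rewrite mulN1r; rewrite mulN1r.
Qed.

Lemma has_mean_cst m : has_mean (fun=> m) m.
Proof.
(* [m] may be negative, so the nonnegative criterion is applied to [1] and the result is scaled. *)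
have h1 : has_mean (fun=> 1) 1.
  apply: ge0_has_mean => //; rewrite (integral_cst P measurableT 1%:E).
  by rewrite mul1e; exact: probability_setT.
by have := has_meanZ m h1; rewrite mulr1.
Qed.

Lemma has_mean_sum n (f : 'I_n -> Om -> R) m :
  (forall i, has_mean (f i) m) ->
  has_mean (fun w => \sum_(i < n) f i w) (n%:R * m).
Proof.
elim: n f => [|n IHn] f fm.
  by under eq_fun do rewrite big_ord0; rewrite mul0r; exact: has_mean_cst.
under eq_fun do rewrite big_ord_recl; rewrite -nat1r mulrDl mul1r.
exact/has_meanD/IHn.
Qed.

Lemma has_mean_ae f g m : measurable_fun setT g ->
  {ae P, forall w, f w = g w} -> has_mean f m -> has_mean g m.
Proof.
move=> mg fg [If mf].
have fgE : ae_eq P setT (EFin \o f) (EFin \o g).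
  by apply: filterS fg => w /= ->.
have mf' := measurable_int _ If.
have mg' : measurable_fun setT (EFin \o g) by exact/measurable_EFinP.
split; last by rewrite -mf; apply/esym/ae_eq_integral.
apply/integrableP; split=> //; have /integrableP[_] := If.
apply: le_lt_trans; rewrite le_eqVlt; apply/orP; left.
apply/eqP/ae_eq_integral => //.
- exact: measurableT_comp.
- exact: measurableT_comp.
- by apply: filterS fg => w /= ->.
Qed.

(** The tail formula for the positive part; at levels [t >= 0] the positive part and [f] have the
    same tail. *)
Lemma integral_maxr0_tail f : measurable_fun setT f ->
  (\int[P]_w (Num.max (f w) 0)%R%:E =
   \int[lebesgue_measure]_(t in `[0%R, +oo[) P [set w | (t < f w)%R])%E.
Proof.
move=> mf; have mmax : measurable_fun setT (fun w => Num.max (f w) 0).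
  exact: measurable_maxr.
pose X := mfun_Sub (mem_set mmax : (fun w => Num.max (f w) 0) \in mfun).
have X0 w : 0 <= X w by rewrite le_max lexx orbT.
have := @ge0_expectation_ccdf _ _ _ P X X0; rewrite unlock => ->.
apply: eq_integral => t; rewrite inE/= in_itv/= andbT => t0; congr (P _).
apply/seteqP; split=> w /=.
  by rewrite in_itv/= andbT lt_max (ltNge t 0) t0 orbF.
by rewrite in_itv/= andbT lt_max => ->.
Qed.

(** Only the tail on [t >= 0] enters, so [f] may be negative; the factor [p] is the probability that
    [f] is positive. *)
Lemma has_mean_exp_tail f p b : 0 < b -> 0 <= p -> measurable_fun setT f ->
  (forall t : R, 0 <= t -> P [set w | t < f w] = (p * expR (- b * t))%:E) ->
  has_mean (fun w => Num.max (f w) 0) (p / b).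
Proof.
move=> b0 p0 mf fp; apply: ge0_has_mean => [|w|].
- exact: measurable_maxr.
- by rewrite le_max lexx orbT.
rewrite integral_maxr0_tail//.
transitivity (\int[lebesgue_measure]_(t in `[0%R, +oo[)
    (p%:E * (expR (- b * t))%:E))%E.
  apply: eq_integral => t; rewrite inE/= in_itv/= andbT => t0.
  by rewrite -EFinM -fp.
rewrite ge0_integralZl_EFin//; last first.
  by apply/measurable_EFinP; exact: measurable_expRM.
by rewrite integral_expR// mulr0 expR0 mul1r.
Qed.

End expectation.

(** * Consequences of independence and of the two laws *)

Section law.
Context {R : realType} {d : measure_display} {Om : measurableType d}.
Context {P : probability Om R}.

(** The event is partitioned by the exact set [S] of indices above threshold. The right-hand side
    depends only on the numbers [ccdf (X p) (a p)], which allows families on different probability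
    spaces to be compared. *)
Lemma indep_threshold_law (I : finType) (X : I -> {RV P >-> R}) (a : I -> R)
    (ok : pred {set I}) : mutually_independent X ->
  P [set w | ok (finset (fun p => a p < X p w))] =
  (\sum_(S \in [set S | ok S]) \prod_p
     (if p \in S then ccdf (X p) (a p) else 1 - ccdf (X p) (a p)))%E.
Proof.
move=> indX.
pose A (S : {set I}) p : set R :=
  if p \in S then `]a p, +oo[%classic else ~` `]a p, +oo[%classic.
have mA S p : measurable (A S p).
  by rewrite /A; case: ifP => _ //; exact: measurableC.
(* The trivial membership is kept so that [F S] has the shape required by [mutually_independent]. *)
pose F S := [set w | forall p, p \in [set: I]%SET -> A S p (X p w)].
have FE S : F S = [set w | finset (fun p => a p < X p w) = S].
  apply/seteqP; split=> w /=.
    move=> AX; apply/setP => p; rewrite inE; have := AX p (finset.in_setT p).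
    by rewrite /A; case: ifP => _ /=; rewrite in_itv/= andbT// => /negP/negbTE.
  move=> <- p _; rewrite /A inE.
  by case: ifPn => /=; rewrite in_itv/= andbT// => /negP.
have -> : [set w | ok (finset (fun p => a p < X p w))] =
    \bigcup_(S in [set S | ok S]) F S.
  apply/seteqP; split=> w /=.
    by move=> okw; exists (finset (fun p => a p < X p w)) => //; rewrite FE.
  by move=> [S /= okS]; rewrite FE /= => ->.
rewrite measure_fin_bigcup//.
- apply: eq_fsbigr => S _; rewrite [LHS](indX [set: I]%SET (A S) (mA S)).
  apply: eq_big => [p|p _]; first by rewrite inE.
  rewrite /A; case: ifP => // _.
  rewrite preimage_setC probability_setC//.
  exact: (@measurable_funPTI _ _ _ _ (X p) _ (measurable_itv _)).
- exact: finite_finset.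
- apply/trivIsetP => S S' _ _ SS'; rewrite !FE.
  by apply/seteqP; split=> // w [/= -> /eqP]; rewrite (negbTE SS').
- move=> S _; rewrite (_ : F S = \bigcap_p (X p @^-1` A S p)); last first.
    apply/seteqP; split=> w /= AX p _; last exact: AX.
    by apply: AX; rewrite inE.
  apply: fin_bigcap_measurable => [|p _]; first exact: finite_finset.
  exact: measurable_funPTI.
Qed.

(** Independence of the whole array, applied to the index set of all [(i, j)] with [j] in [L]. *)
Lemma indep_row (I J : finType) (X : I * J -> {RV P >-> R}) i
    (L : {set J}) (B : J -> set R) :
  mutually_independent X -> (forall j, measurable (B j)) ->
  P [set w | forall j, j \in L -> B j (X (i, j) w)] =
  (\prod_(j in L) P (X (i, j) @^-1` B j))%E.
Proof.
move=> indX mB.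
have := indX (pair i @: L) (fun p => B p.2) (fun p => mB p.2).
rewrite big_imset/=; last by move=> j j' _ _ [].
move=> <-; congr (P _); apply/seteqP; split=> w /= BX.
  by move=> p /imsetP[j jL ->]; exact: BX.
by move=> j jL; exact: (BX (i, j) (imset_f _ jL)).
Qed.

Lemma exp_law_sexp mu (X : {RV P >-> R}) : 0 < mu ->
  has_exp_law mu X -> has_sexp_law 0 mu X.
Proof.
move=> mu0 expX.
have tail x : 0 <= x -> ccdf X x = (expR (- mu * x))%:E.
  move=> x0; rewrite /ccdf expX// /exponential_prob.
  transitivity (\int[lebesgue_measure]_(y in `]x, +oo[)
      (mu%:E * (expR (- mu * y))%:E))%E.
    apply: eq_integral => y; rewrite inE/= in_itv/= andbT => xy.
    by rewrite exponential_pdfE// (le_trans x0)// ltW.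
  have mexp : measurable_fun `]x, +oo[ (fun y => (expR (- mu * y))%:E).
    by apply/measurable_EFinP; exact: measurable_expRM.
  rewrite ge0_integralZl_EFin//; last exact: ltW.
  rewrite integral_itv_obnd_cbnd// integral_expR// -EFinM mulrC divfK//.
  by rewrite gt_eqF.
move=> x; rewrite subr0; case: ifPn => [/tail//|]; rewrite -ltNge => x0.
(* For [x < 0], monotonicity bounds the value from below by the one at [0], which is [1]. *)
apply/le_anti; rewrite probability_le1//=.
by have := ccdf_nonincreasing X (ltW x0); rewrite tail// mulr0 expR0.
Qed.

Lemma ccdfE (X : {RV P >-> R}) x : ccdf X x = P [set w | x < X w].
Proof.
by congr (P _); apply/seteqP; split=> w /=; rewrite in_itv/= andbT.
Qed.

Lemma sexp_law_ae_gt s mu (X : {RV P >-> R}) :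
  has_sexp_law s mu X -> {ae P, forall w, s < X w}.
Proof.
move=> /(_ s); rewrite lexx subrr mulr0 expR0 ccdfE => Xs.
have ms : measurable [set w | s < X w].
  exact/measurable_gtr/measurable_funPT.
apply/negligibleP; first exact: measurableC.
by rewrite [LHS](probability_setC P ms) Xs subee.
Qed.

End law.

(** * The replication model; [s = 0] is allowed, so that the exponential model is covered too *)

Section sexp_model.
Context {R : realType} {k c : nat} (k_gt0 : (0 < k)%N) {s mu D : R}.
Context (s_ge0 : 0 <= s) (mu_gt0 : 0 < mu) (D_ge0 : 0 <= D).
Context {d : measure_display} {Om : measurableType d} {P : probability Om R}.
Context {X : 'I_k -> 'I_c.+1 -> {RV P >-> R}}.
Context (X_indep : mutually_independent (fun p : 'I_k * 'I_c.+1 => X p.1 p.2)).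
Context (X_law : forall i l, has_sexp_law s mu (X i l)).

Let x w : 'I_k -> 'I_c.+1 -> R := fun i l => X i l w.

Lemma ae_copies_gt : {ae P, forall w, forall i l, s < x w i l}.
Proof.
apply: filter_forall => i; apply: filter_forall => l.
exact: sexp_law_ae_gt (X_law i l).
Qed.

Lemma measurable_copy i l : measurable_fun setT (fun w => x w i l).
Proof. exact: measurable_funPT. Qed.

Lemma measurable_min_time i : measurable_fun setT (fun w => min_time D (x w) i).
Proof.
apply: measurable_bigr => [f g||l].
- exact: measurable_minr.
- exact: measurable_copy.
- by apply: measurable_funD => //; exact: measurable_copy.
Qed.

Lemma measurable_task_time i :
  measurable_fun setT (fun w => task_time D (x w) i).
Proof.
apply: measurable_fun_ifT; last 2 first.
- exact: measurable_copy.
- exact: measurable_min_time.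
by apply: measurable_fun_ler => //; exact: measurable_copy.
Qed.

Lemma measurable_job_time :
  measurable_fun setT (fun w => job_time k_gt0 D (x w)).
Proof.
apply: measurable_bigr => [f g||i]; [exact: measurable_maxr| |];
  exact: measurable_task_time.
Qed.

Lemma ae_task_timeE :
  {ae P, forall w, forall i, task_time D (x w) i = min_time D (x w) i}.
Proof.
apply: filterS ae_copies_gt => w xs i; apply: task_timeE => l.
exact/(le_trans s_ge0)/ltW.
Qed.

(** Off a null set, the job outlasts [t] iff all copies of some task exceed their thresholds; this
    is the predicate on [S]. *)
Lemma job_time_law t :
  P [set w | t < job_time k_gt0 D (x w)] =
  (\sum_(S \in [set S : {set 'I_k * 'I_c.+1} |
                 [exists i, forall l, (i, l) \in S]])
    \prod_p (if p \in S then ccdf (X p.1 p.2) (t - launch D p.2)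
             else 1 - ccdf (X p.1 p.2) (t - launch D p.2)))%E.
Proof.
pose Tm w :=
  \big[Num.max/min_time D (x w) (Ordinal k_gt0)]_(i < k) min_time D (x w) i.
rewrite -(indep_threshold_law (fun p => t - launch D p.2)
  (fun S => [exists i, forall l, (i, l) \in S]) X_indep).
transitivity (P [set w | t < Tm w]).
  apply: ae_eq_prob.
  - exact/measurable_gtr/measurable_job_time.
  - apply/measurable_gtr/measurable_bigr => [f g||i]; last 2 first.
    + exact: measurable_min_time.
    + exact: measurable_min_time.
    exact: measurable_maxr.
  - apply: filterS ae_task_timeE => w xE.
    by rewrite /= /job_time xE (eq_bigr _ (fun i _ => xE i)).
congr (P _); apply/seteqP; split=> w /=.
  move=> tT; suff [i /min_time_gtP ti] : exists i, t < min_time D (x w) i.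
    by apply/existsP; exists i; apply/forallP => l; rewrite inE; exact: ti.
  by case/bigmax_gtP: tT => [?|[i _ ?]]; [exists (Ordinal k_gt0)|exists i].
move=> /existsP[i /forallP ti]; apply/bigmax_gtP; right; exists i => //.
by apply/min_time_gtP => l; have := ti l; rewrite inE.
Qed.

Lemma ae_job_time_ge : {ae P, forall w, s <= job_time k_gt0 D (x w)}.
Proof.
near=> w.
have xs : forall i l, s < x w i l by near: w; exact: ae_copies_gt.
have xE : forall i, task_time D (x w) i = min_time D (x w) i.
  by near: w; exact: ae_task_timeE.
apply: le_trans (bigmax_ge_id _ _ _ _); rewrite xE.
apply: min_time_ge => [|l]; first exact: ltW.
by rewrite (le_trans _ (ltW (xs _ l)))// lerBlDr lerDl.
Unshelve. all: by end_near. Qed.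

(** Memorylessness above [s]: exceeding [u + t] has probability [expR (- mu * (u - s))] times
    [expR (- mu * t)]. *)
Lemma has_mean_copy_excess i l u : s <= u ->
  has_mean P (fun w => Num.max (x w i l - u) 0) (expR (- mu * (u - s)) / mu).
Proof.
move=> su; apply: has_mean_exp_tail => //.
  by apply: measurable_funB => //; exact: measurable_copy.
move=> t t0; under eq_set do rewrite ltrBrDr.
rewrite -ccdfE X_law ler_wpDl// -expRD; congr (expR _)%:E; ring.
Qed.

Lemma has_mean_copy i l : has_mean P (fun w => x w i l) (s + mu^-1).
Proof.
have := has_meanD (has_mean_cst P s) (has_mean_copy_excess i l (lexx s)).
rewrite subrr mulr0 expR0 div1r; apply: has_mean_ae.
  exact: measurable_copy.
apply: filterS ae_copies_gt => w xs.
by rewrite max_l ?subr_ge0 ?(ltW (xs _ _))// addrC subrK.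
Qed.

(** At level [D + s + t] the original is [D + t] beyond its shift and each of the [c] replicas is
    [t] beyond its own. The product of the tails has rate [c.+1%:R * mu] and prefactor
    [expR (- mu * D)]. *)
Lemma has_mean_min_time_tail i :
  has_mean P (fun w => Num.max (min_time D (x w) i - (D + s)) 0)
    (expR (- mu * D) / (c.+1%:R * mu)).
Proof.
apply: has_mean_exp_tail; [by rewrite mulr_gt0|by []| |].
  by apply: measurable_funB => //; exact: measurable_min_time.
move=> t t0.
pose B (l : 'I_c.+1) : set R := `]t + (D + s) - launch D l, +oo[%classic.
transitivity (P [set w | forall l, l \in [set: 'I_c.+1]%SET -> B l (X i l w)]).
  congr (P _); apply/seteqP; split=> w /=.
    rewrite ltrBrDr => /min_time_gtP tx l _.
    by rewrite /B/= in_itv/= andbT; exact: tx.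
  move=> tx; rewrite ltrBrDr; apply/min_time_gtP => l.
  by have := tx l (finset.in_setT _); rewrite /B/= in_itv/= andbT.
have mB l : measurable (B l) by exact: measurable_itv.
rewrite (indep_row i _ X_indep mB)/=.
under eq_bigl do rewrite inE.
have BE l : P (X i l @^-1` B l) =
    (if l == ord0 then expR (- mu * (t + D)) else expR (- mu * t))%:E.
  rewrite -[LHS]/(ccdf (X i l) _) X_law /launch.
  case: (l == ord0).
    rewrite subr0 addrA lerDr addr_ge0//; congr (expR _)%:E; ring.
  rewrite (_ : _ + _ - D = t + s); last ring.
  by rewrite lerDr t0 addrK.
rewrite (eq_bigr _ (fun l _ => BE l)) prodEFin; congr EFin.
rewrite big_ord_recl/= prodr_const card_ord -expRM_natl -!expRD.
by congr expR; rewrite -natr1; ring.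
Qed.

Lemma has_mean_min_time i :
  has_mean P (fun w => min_time D (x w) i)
    (s + mu^-1 - expR (- mu * D) / mu + expR (- mu * D) / (c.+1%:R * mu)).
Proof.
have sDs : s <= D + s by rewrite lerDr.
have := has_meanD (has_meanB (has_meanD (has_mean_cst P s)
  (has_mean_copy_excess i ord0 (lexx s))) (has_mean_copy_excess i ord0 sDs))
  (has_mean_min_time_tail i).
rewrite subrr mulr0 expR0 div1r addrK; apply: has_mean_ae.
  exact: measurable_min_time.
apply: filterS ae_copies_gt => w xs; apply/esym/min_time_split => // l.
exact: ltW.
Qed.

Lemma has_mean_min_time_excess i :
  has_mean P (fun w => Num.max (min_time D (x w) i - D) 0)
    ((if D <= s then s + mu^-1 - D else expR (- mu * (D - s)) / mu)
     - expR (- mu * D) / mu + expR (- mu * D) / (c.+1%:R * mu)).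
Proof.
have mmax : measurable_fun setT (fun w => Num.max (min_time D (x w) i - D) 0).
  apply: measurable_maxr => //.
  by apply: measurable_funB => //; exact: measurable_min_time.
case: ifPn => [Ds|]; last first.
  rewrite -ltNge => /ltW sD.
  have sDs : s <= D + s by rewrite lerDr.
  have := has_meanD (has_meanB (has_mean_copy_excess i ord0 sD)
    (has_mean_copy_excess i ord0 sDs)) (has_mean_min_time_tail i).
  rewrite addrK; apply: has_mean_ae => //.
  apply: filterS ae_copies_gt => w xs; apply/esym/min_time_excess => // l.
  exact: ltW.
have := has_meanB (has_mean_min_time i) (has_mean_cst P D).
rewrite [X in has_mean _ _ X](_ : _ = s + mu^-1 - D - expR (- mu * D) / mu
  + expR (- mu * D) / (c.+1%:R * mu)); last ring.
apply: has_mean_ae => //; apply: filterS ae_copies_gt => w xs.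
rewrite max_l// subr_ge0; apply: min_time_ge => [|l].
  by rewrite (le_trans Ds)// ltW.
by rewrite subrr (le_trans s_ge0)// ltW.
Qed.

Lemma expectation_cost_cancel : ('E_P[fun w => cost_cancel D (x w)])%E =
  (k%:R * (s + mu^-1 - expR (- mu * D) / mu + expR (- mu * D) / (c.+1%:R * mu)
   + c%:R * ((if D <= s then s + mu^-1 - D else expR (- mu * (D - s)) / mu)
     - expR (- mu * D) / mu + expR (- mu * D) / (c.+1%:R * mu))))%:E.
Proof.
have := has_mean_sum (fun i => has_meanD (has_mean_min_time i)
  (has_meanZ c%:R (has_mean_min_time_excess i))).
move=> /has_mean_ae mC; apply/has_meanE/mC.
  apply: measurable_sum => i; apply: measurable_fun_ifT.
  - by apply: measurable_fun_ler => //; exact: measurable_copy.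
  - exact: measurable_copy.
  - apply: measurable_funD => //; apply: measurable_funM => //.
    by apply: measurable_funB => //; exact: measurable_task_time.
apply: filterS ae_copies_gt => w xs; apply/esym/cost_cancelE => i l.
exact/(le_trans s_ge0)/ltW.
Qed.

(** The probability that the original outlasts [D], in the form given by [has_sexp_law]. *)
Let p0 := if s <= D then expR (- mu * (D - s)) else 1.

Lemma has_mean_replica i l :
  has_mean P (fun w => (D < x w i ord0)%R%:R * x w i (lift ord0 l))
    (p0 * (s + mu^-1)).
Proof.
have mD : measurable [set w | D < x w i ord0].
  exact/measurable_gtr/measurable_copy.
have mind : measurable_fun setT (fun w => (D < x w i ord0)%R%:R : R).
  rewrite (_ : (fun w => _) = \1_[set w | D < x w i ord0]).
    exact: measurable_indic.
  by apply/funext => w; rewrite indicE mem_setE.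
have ind : has_mean P (fun w => (D < x w i ord0)%R%:R) p0.
  apply: ge0_has_mean => //.
  transitivity (\int[P]_w (\1_[set w | D < x w i ord0] w)%:E)%E.
    by apply: eq_integral => w _; rewrite indicE mem_setE.
  rewrite integral_indic// setIT.
  by rewrite -[RHS](X_law i ord0 D) ccdfE.
(* The summand is [s] times the indicator plus [f], and [f] is almost surely nonnegative. *)
pose f w := (D < x w i ord0)%R%:R * (x w i (lift ord0 l) - s).
have mf : measurable_fun setT f.
  by apply: measurable_funM => //; exact: measurable_funB.
have fmean : has_mean P (fun w => Num.max (f w) 0) (p0 / mu).
  apply: has_mean_exp_tail => // [|t t0].
    by rewrite /p0; case: ifP => _ //; exact: expR_ge0.
  (* [B] is evaluated only at [ord0] and [lift ord0 l], so its second branch stands for that one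
     replica. *)
  pose B (j : 'I_c.+1) : set R :=
    if j == ord0 then `]D, +oo[%classic else `]t + s, +oo[%classic.
  transitivity (P [set w | forall j,
      j \in [set ord0; lift ord0 l]%SET -> B j (X i j w)]).
    congr (P _); apply/seteqP; split=> w /=.
      rewrite /f; have [Dx|_] := ltP D (x w i ord0); last first.
        by rewrite mul0r ltNge t0.
      rewrite mul1r ltrBrDr => tx j; rewrite !inE => /orP[]/eqP->;
      by rewrite /B/= in_itv/= andbT.
    move=> tx; have := tx ord0; have := tx (lift ord0 l).
    rewrite !inE !eqxx orbT /B/= !in_itv/= !andbT => /(_ isT) tx1 /(_ isT) Dx.
    by rewrite /f -/(x w) Dx mul1r ltrBrDr.
  have mB j : measurable (B j) by rewrite /B; case: ifP.
  rewrite (indep_row i _ X_indep mB)/= big_setU1/=; last by rewrite inE.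
  rewrite big_set1 -[P (X i ord0 @^-1` _)]/(ccdf (X i ord0) D).
  rewrite -[P (X i (lift _ _) @^-1` _)]/(ccdf (X i (lift ord0 l)) (t + s)).
  by rewrite !X_law ler_wpDl// addrK -EFinM.
have := has_meanD (has_meanZ s ind) fmean.
rewrite (mulrC s) -mulrDr; apply: has_mean_ae.
  by apply: measurable_funM => //; exact: measurable_copy.
apply: filterS ae_copies_gt => w xs.
rewrite max_l; first by rewrite /f; ring.
by rewrite mulr_ge0// subr_ge0 ltW.
Qed.

Lemma expectation_cost_no_cancel : ('E_P[fun w => cost_no_cancel D (x w)])%E =
  (k%:R * (s + mu^-1 + c%:R * (p0 * (s + mu^-1))))%:E.
Proof.
have := has_mean_sum (fun i => has_meanD (has_mean_copy i ord0)
  (has_mean_sum (has_mean_replica i))).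
move=> /has_meanE <-; rewrite /cost_no_cancel; congr ('E_P[_])%E.
by apply/funext => w; apply: eq_bigr => i _; rewrite mulr_sumr.
Qed.

(** Almost surely the job time equals [s] plus a positive part. The identity is in the extended
    reals, so finiteness of the mean need not be shown. *)
Lemma expectation_job_time : ('E_P[fun w => job_time k_gt0 D (x w)] =
  s%:E + \int[lebesgue_measure]_(t in `[0%R, +oo[)
    P [set w | (t < job_time k_gt0 D (x w) - s)%R])%E.
Proof.
set T := fun w => job_time k_gt0 D (x w).
have mT := measurable_job_time : measurable_fun setT T.
have mTs : measurable_fun setT (fun w => T w - s) by exact: measurable_funB.
have mmax : measurable_fun setT (fun w => Num.max (T w - s) 0).
  exact: measurable_maxr.
have max0 w : 0 <= Num.max (T w - s) 0 by rewrite le_max lexx orbT.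
transitivity (\int[P]_w (s%:E + (Num.max (T w - s) 0)%:E))%E.
  rewrite unlock; apply: ae_eq_integral => //.
  - exact/measurable_EFinP.
  - by apply: emeasurable_funD => //; exact/measurable_EFinP.
  apply: filterS ae_job_time_ge => w sT _.
  by rewrite -EFinD max_l ?subr_ge0// addrC subrK.
rewrite ge0_integralD//; last 2 first.
- by move=> w _; rewrite lee_fin.
- exact/measurable_EFinP.
rewrite (has_mean_cst P s).2; congr +%E.
exact: integral_maxr0_tail.
Qed.

End sexp_model.

Theorem theorem2 (R : realType) (k c : nat) (k_gt0 : (0 < k)%N)
    (s mu D : R) (s_gt0 : 0 < s) (mu_gt0 : 0 < mu) (D_ge0 : 0 <= D)
    (d : measure_display) (Om : measurableType d) (P : probability Om R)
    (X : 'I_k -> 'I_c.+1 -> {RV P >-> R})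
    (X_indep : mutually_independent (fun p : 'I_k * 'I_c.+1 => X p.1 p.2))
    (X_law : forall i l, has_sexp_law s mu (X i l))
    (d' : measure_display) (Om' : measurableType d') (P' : probability Om' R)
    (E : 'I_k -> 'I_c.+1 -> {RV P' >-> R})
    (E_indep : mutually_independent (fun p : 'I_k * 'I_c.+1 => E p.1 p.2))
    (E_law : forall i l, has_exp_law mu (E i l)) :
  let q : R := (s < D)%R%:R * (1 - expR (- mu * (D - s))) in
  let T := fun w : Om => job_time k_gt0 D (fun i l => X i l w) in
  let Te := fun w : Om' => job_time k_gt0 D (fun i l => E i l w) in
  let Cc := fun w : Om => cost_cancel D (fun i l => X i l w) in
  let C := fun w : Om => cost_no_cancel D (fun i l => X i l w) in
  [/\ forall t : R, P [set w | t < T w] = P' [set w | t - s < Te w],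
      ('E_P[T] = s%:E + 'E_P'[Te])%E,
      'E_P[Cc]%E =
        (if D <= s then
           k%:R * (c%:R + 1) *
             (s + mu^-1 *
                (1 - c%:R / (c%:R + 1) * (expR (- mu * D) + mu * D)))
         else
           k%:R * (s + mu^-1 * (1 + c%:R * (1 - q - expR (- mu * D)))))%:E
    & 'E_P[C]%E = (k%:R * (c%:R * (1 - q) + 1) * (s + mu^-1))%:E].
Proof.
move=> q T Te Cc C.
(* The exponential law is the case of shift [0], so the same lemmas serve both models. *)
have E_sexp i l : has_sexp_law 0 mu (E i l) by exact: exp_law_sexp.
have s_ge0 := ltW s_gt0.
have tailE t : P [set w | t < T w] = P' [set w | t - s < Te w].
  rewrite (job_time_law k_gt0 s_ge0 X_indep X_law).
  rewrite (job_time_law k_gt0 (lexx 0) E_indep E_sexp).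
  apply: eq_fsbigr => S _; apply: eq_bigr => p _.
  (* Subtracting [s] from [t] shifts every threshold by [s], whatever the launch time, so each
     factor is unchanged. *)
  have -> // : ccdf (X p.1 p.2) (t - launch D p.2) =
               ccdf (E p.1 p.2) (t - s - launch D p.2).
  by rewrite X_law E_sexp subr0 [t - s - _]addrAC subr_ge0.
split=> //.
- rewrite (expectation_job_time k_gt0 s_ge0 D_ge0 X_law).
  rewrite (expectation_job_time k_gt0 (lexx 0) D_ge0 E_sexp) add0e.
  congr +%E; apply: eq_integral => t _.
  transitivity (P [set w | t + s < T w]).
    by congr (P _); apply/seteqP; split=> w /=; rewrite ltrBrDr.
  rewrite tailE addrK.
  by congr (P' _); apply/seteqP; split=> w /=; rewrite subr0.
- rewrite (expectation_cost_cancel s_ge0 mu_gt0 D_ge0 X_indep X_law).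
  have c1 : c%:R + 1 != 0 :> R by rewrite natr1.
  have mu0 : mu != 0 by rewrite gt_eqF.
  congr EFin; case: ifPn => [_|].
    by rewrite -natr1; field; rewrite c1 mu0.
  rewrite -ltNge /q => ->; rewrite mul1r -natr1.
  by field; rewrite c1 mu0.
- rewrite (expectation_cost_no_cancel mu_gt0 X_indep X_law).
  (* [q] tests [s < D] but [p0] tests [s <= D]; at [s = D] both [p0] and [1 - q] equal [1]. *)
  congr EFin; rewrite /q; case: (ltgtP s D) => [_|_|->].
  + by rewrite mul1r; ring.
  + by rewrite mul0r; ring.
  + by rewrite mul0r subrr mulr0 expR0; ring.
Qed.
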